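(* Let $(G,J_G)$ and $(M,J_M)$ be a matched pair of finite almost groups with actions $\triangleright,\triangleleft$, and let $k$ be a field. Let $H$ be the $k$-vector space with basis $\{s\otimes\delta_u: s\in M,\ u\in G\}$ and let $H_J=kJ_M\otimes k(J_G)$ have basis $\{j\otimes\delta_n: j\in J_M,\ n\in J_G\}$, with product $(j\otimes\delta_n)(j'\otimes\delta_{n'})=\delta_{n,n'}\,jj'\otimes\delta_{n'}$ on $H_J$. Then the linear operations $$(s\otimes\delta_u)(t\otimes\delta_v)=\delta_{u,\,t\triangleright v}\,(st\otimes\delta_v),\qquad \Delta(s\otimes\delta_u)=\sum_{x,y\in G:\,xy=u} s\otimes\delta_x\otimes (s\triangleleft x)\otimes\delta_y,$$ $$S(s\otimes\delta_u)=(s\triangleleft u)^i\otimes\delta_{(s\triangleright u)^i},\qquad \epsilon(s\otimes\delta_u)=\begin{cases}0,& u\notin J_G\\ ss^i\otimes\delta_u,& u\in J_G,\end{cases}$$ $$\eta(j\otimes\delta_n)=\sum_{z\in G:\,zz^i=n} j\otimes\delta_z\qquad (j\in J_M,\ n\in J_G)$$ make $(H,+,\cdot,\eta,\Delta,\epsilon,S;H_J)$ an almost Hopf algebra.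
   Context: **Almost group.** An almost group $(G,J)$ is a set $G$ with an associative binary operation, a bijection $i:G\to G$, $g\mapsto g^i$, and a subset $J\subset G$ closed under the binary operation and under $i$, such that: $(gh)^i=h^ig^i$ for all $g,h\in G$; $jg=gj$ for all $g\in G$, $j\in J$; $gg^i=g^ig\in J$ for all $g\in G$; $(g^i)^i=g$ for all $g\in G$. **Matched pair.** A matched pair of almost groups $(G,J_G)$, $(M,J_M)$ consists of functions $\triangleright:M\times G\to G$ and $\triangleleft:M\times G\to M$ such that for all $s,t\in M$, $u,v\in G$: $s\triangleleft uv=(s\triangleleft u)\triangleleft v$; $st\triangleleft u=(s\triangleleft(t\triangleright u))(t\triangleleft u)$; $st\triangleright u=s\triangleright(t\triangleright u)$; $s\triangleright uv=(s\triangleright u)((s\triangleleft u)\triangleright v)$; $(s\triangleleft u)^i\triangleright(s\triangleright u)^i=u^i$; $(s\triangleleft u)^i\triangleleft(s\triangleright u)^i=s^i$; $j\triangleright u=u$ and $j\triangleleft u=j$ for all $j\in J_M$; $s\triangleright j=j$ and $s\triangleleft j=s$ for all $j\in J_G$. **Almost Hopf algebra.** An almost Hopf algebra $(H,+,\cdot,\eta,\Delta,\epsilon,S;H_J)$ over $k$ is an associative (not necessarily unital) $k$-algebra $H$ together with: a commutative associative algebra $H_J$; a coassociative linear map $\Delta:H\to H\otimes H$; a linear map $\epsilon:H\to H_J$ with $(\epsilon\otimes\mathrm{id})\Delta(h)=\tau(\mathrm{id}\otimes\epsilon)\Delta(h)$ for all $h\in H$, where $\tau(h\otimes j)=j\otimes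 h$; a linear map $\eta:H_J\to H$ with $\cdot(\eta\otimes\mathrm{id})=\cdot(\mathrm{id}\otimes\eta)\tau:H_J\otimes H\to H$, where $\tau$ is the flip; a linear map $S:H\to H$ with $\cdot(S\otimes\mathrm{id})\Delta(h)=\cdot(\mathrm{id}\otimes S)\Delta(h)=\eta(\epsilon(h))$ for all $h\in H$; and such that $\Delta,\epsilon,\eta$ are algebra maps (i.e. multiplicative linear maps). Here $\delta_{u,v}$ is the Kronecker delta. *)

(* Defs.v *)
From HB Require Import structures.
From mathcomp Require Import all_boot all_order all_algebra.
From mathcomp Require Import boolp.

Set Implicit Arguments.
Unset Strict Implicit.
Unset Printing Implicit Defensive.

Import GRing.Theory.
Local Open Scope ring_scope.
Local Open Scope quotient_scope.

(** * Tensor products of vector spaces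

    An element of [tensor V W] is a class of formal sums of pairs [(v, w)]
    (scalars are absorbed in [v]); two formal sums are identified exactly when
    every bilinear map takes the same value on both.  The universal property is
    [tlift_pure] (existence) together with [tensor_ext] (uniqueness). *)

Section Tensor.
Variables (k : fieldType) (V W : lmodType k).

Definition formal_eval (Z : lmodType k) (f : V -> W -> Z) (s : seq (V * W)) : Z :=
  \sum_(p <- s) f p.1 p.2.

Definition tensor_eq (s t : seq (V * W)) : bool :=
  `[< forall (Z : lmodType k) (f : {bilinear V -> W -> Z}),
        formal_eval f s = formal_eval f t >].

Fact tensor_eq_refl : reflexive tensor_eq.
Proof. by move=> s; apply/asboolP. Qed.
Fact tensor_eq_sym : symmetric tensor_eq.
Proof. by move=> s t; apply/asboolP/asboolP => st Z f; rewrite st. Qed.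
Fact tensor_eq_trans : transitive tensor_eq.
Proof.
by move=> t s u /asboolP st /asboolP tu; apply/asboolP => Z f; rewrite st tu.
Qed.

Canonical tensor_equiv :=
  EquivRel tensor_eq tensor_eq_refl tensor_eq_sym tensor_eq_trans.

Definition tensor := {eq_quot tensor_eq}.
HB.instance Definition _ := Choice.on tensor.

Definition pure (v : V) (w : W) : tensor := \pi_tensor [:: (v, w)].

Definition tensor_lift (Z : lmodType k) (f : V -> W -> Z) (t : tensor) : Z :=
  formal_eval f (repr t).

Lemma tensor_liftE (Z : lmodType k) (f : {bilinear V -> W -> Z}) s :
  tensor_lift f (\pi_tensor s) = formal_eval f s.
Proof.
rewrite /tensor_lift; case: piP => t /eqmodP /asboolP /= st.
by rewrite st.
Qed.

(* bilinear maps separate tensors *)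
Lemma tensor_sep (t u : tensor) :
  (forall (Z : lmodType k) (f : {bilinear V -> W -> Z}),
     tensor_lift f t = tensor_lift f u) -> t = u.
Proof.
by move=> tu; rewrite -[t]reprK -[u]reprK; apply/eqmodP/asboolP => Z f; exact: tu.
Qed.

Definition tensor_zero : tensor := \pi_tensor [::].
Definition tensor_add (t u : tensor) : tensor := \pi_tensor (repr t ++ repr u).
Definition tensor_scale (a : k) (t : tensor) : tensor :=
  \pi_tensor [seq (a *: p.1, p.2) | p <- repr t].
Definition tensor_opp (t : tensor) : tensor := tensor_scale (-1) t.

Section LiftE.
Variables (Z : lmodType k) (f : {bilinear V -> W -> Z}).
Fact tensor_lift0 : tensor_lift f tensor_zero = 0.
Proof. by rewrite tensor_liftE /formal_eval big_nil. Qed.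
Fact tensor_liftD t u :
  tensor_lift f (tensor_add t u) = tensor_lift f t + tensor_lift f u.
Proof. by rewrite tensor_liftE /formal_eval big_cat. Qed.
Fact tensor_liftZ a t : tensor_lift f (tensor_scale a t) = a *: tensor_lift f t.
Proof.
rewrite tensor_liftE /formal_eval big_map scaler_sumr.
by apply: eq_bigr => p _; rewrite linearZl_LR.
Qed.
Fact tensor_liftN t : tensor_lift f (tensor_opp t) = - tensor_lift f t.
Proof. by rewrite tensor_liftZ scaleN1r. Qed.
Definition tensor_liftsE := (tensor_lift0, tensor_liftN, tensor_liftD, tensor_liftZ).
End LiftE.

Fact tensor_addA : associative tensor_add.
Proof. by move=> t u v; apply: tensor_sep => Z f; rewrite !tensor_liftsE addrA. Qed.
Fact tensor_addC : commutative tensor_add.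
Proof. by move=> t u; apply: tensor_sep => Z f; rewrite !tensor_liftsE addrC. Qed.
Fact tensor_add0 : left_id tensor_zero tensor_add.
Proof. by move=> t; apply: tensor_sep => Z f; rewrite !tensor_liftsE add0r. Qed.
Fact tensor_addN : left_inverse tensor_zero tensor_opp tensor_add.
Proof. by move=> t; apply: tensor_sep => Z f; rewrite !tensor_liftsE addNr. Qed.

HB.instance Definition _ :=
  GRing.isZmodule.Build tensor tensor_addA tensor_addC tensor_add0 tensor_addN.

Fact tensor_scaleA a b t :
  tensor_scale a (tensor_scale b t) = tensor_scale (a * b) t.
Proof. by apply: tensor_sep => Z f; rewrite !tensor_liftsE scalerA. Qed.
Fact tensor_scale1 : left_id 1 tensor_scale.
Proof. by move=> t; apply: tensor_sep => Z f; rewrite !tensor_liftsE scale1r. Qed.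
Fact tensor_scaleDr : right_distributive tensor_scale +%R.
Proof. by move=> a t u; apply: tensor_sep => Z f; rewrite !tensor_liftsE scalerDr. Qed.
Fact tensor_scaleDl t : {morph tensor_scale^~ t : a b / a + b}.
Proof. by move=> a b; apply: tensor_sep => Z f; rewrite !tensor_liftsE scalerDl. Qed.

HB.instance Definition _ := GRing.Zmodule_isLmodule.Build k tensor
  tensor_scaleA tensor_scale1 tensor_scaleDr tensor_scaleDl.

Definition tlift (Z : lmodType k) (f : {bilinear V -> W -> Z}) : tensor -> Z :=
  tensor_lift f.

Fact tlift_linear (Z : lmodType k) (f : {bilinear V -> W -> Z}) : linear (tlift f).
Proof. by move=> a t u; rewrite /tlift tensor_liftD tensor_liftZ. Qed.
HB.instance Definition _ (Z : lmodType k) (f : {bilinear V -> W -> Z}) :=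
  GRing.isLinear.Build k tensor Z _ (@tlift Z f) (tlift_linear f).

Lemma tlift_pure (Z : lmodType k) (f : {bilinear V -> W -> Z}) v w :
  tlift f (pure v w) = f v w.
Proof. by rewrite /tlift tensor_liftE /formal_eval big_seq1. Qed.

Fact pure_bilinear : bilinear_for *:%R *:%R pure.
Proof.
by split=> [w a v v'|v a w w']; apply: tensor_sep => Z f;
  rewrite tensor_liftD tensor_liftZ !tensor_liftE /formal_eval !big_seq1 /=
          ?linearPl ?linearPr.
Qed.
HB.instance Definition _ :=
  bilinear_isBilinear.Build k V W tensor *:%R *:%R pure pure_bilinear.

Lemma tensor_sum_pure (t : tensor) : t = \sum_(p <- repr t) pure p.1 p.2.
Proof.
apply: tensor_sep => Z f; rewrite -!/(tlift f _) linear_sum /=.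
by under eq_bigr do rewrite tlift_pure.
Qed.

Lemma tensor_ext (Z : lmodType k) (f g : {linear tensor -> Z}) :
  (forall v w, f (pure v w) = g (pure v w)) -> f =1 g.
Proof.
move=> fg t; rewrite [t]tensor_sum_pure !linear_sum.
by apply: eq_bigr => p _; exact: fg.
Qed.

End Tensor.

Notation "V ⊗ W" := (tensor V W) (at level 40, left associativity) : type_scope.
Notation "v *t w" := (pure v w) (at level 40, left associativity) : ring_scope.

Section TensorMaps.
Variable k : fieldType.

Section Map.
Variables (A B A' B' : lmodType k) (f : {linear A -> A'}) (g : {linear B -> B'}).
Definition tmap_fun (a : A) (b : B) : A' ⊗ B' := f a *t g b.
Fact tmap_bilinear : bilinear_for *:%R *:%R tmap_fun.
Proof.
by split=> [b c a a'|a c b b']; rewrite /tmap_fun linearP ?linearPl ?linearPr.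
Qed.
HB.instance Definition _ :=
  bilinear_isBilinear.Build k A B (A' ⊗ B')%type *:%R *:%R tmap_fun tmap_bilinear.
Definition tmap : {linear (A ⊗ B)%type -> (A' ⊗ B')%type} := tlift tmap_fun.
Lemma tmapE a b : tmap (a *t b) = f a *t g b.
Proof. exact: tlift_pure. Qed.
End Map.

Section Flip.
Variables (A B : lmodType k).
Definition tflip_fun (a : A) (b : B) : B ⊗ A := b *t a.
Fact tflip_bilinear : bilinear_for *:%R *:%R tflip_fun.
Proof. by split=> [b c a a'|a c b b']; rewrite /tflip_fun ?linearPl ?linearPr. Qed.
HB.instance Definition _ :=
  bilinear_isBilinear.Build k A B (B ⊗ A)%type *:%R *:%R tflip_fun tflip_bilinear.
Definition tflip : {linear (A ⊗ B)%type -> (B ⊗ A)%type} := tlift tflip_fun.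
Lemma tflipE a b : tflip (a *t b) = b *t a.
Proof. exact: tlift_pure. Qed.
End Flip.

Section Assoc.
Variables (A B C : lmodType k).

Definition tassoc_fun1 (c : C) (a : A) (b : B) : A ⊗ (B ⊗ C)%type := a *t (b *t c).
Fact tassoc_bilinear1 c : bilinear_for *:%R *:%R (tassoc_fun1 c).
Proof.
by split=> [b e a a'|a e b b']; rewrite /tassoc_fun1 ?linearPl ?linearPr.
Qed.
HB.instance Definition _ c := bilinear_isBilinear.Build k A B
  (A ⊗ (B ⊗ C)%type)%type *:%R *:%R (tassoc_fun1 c) (tassoc_bilinear1 c).
Definition tassoc_fun (t : A ⊗ B) (c : C) : A ⊗ (B ⊗ C)%type :=
  tlift (tassoc_fun1 c) t.
Fact tassoc_bilinear : bilinear_for *:%R *:%R tassoc_fun.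
Proof.
split=> [c e t t'|t e c c']; rewrite /tassoc_fun; first by rewrite linearP.
rewrite [t]tensor_sum_pure !linear_sum /= scaler_sumr -big_split /=.
by apply: eq_bigr => p _; rewrite !tlift_pure /= /tassoc_fun1 !linearPr.
Qed.
HB.instance Definition _ := bilinear_isBilinear.Build k (A ⊗ B)%type C
  (A ⊗ (B ⊗ C)%type)%type *:%R *:%R tassoc_fun tassoc_bilinear.
Definition tassoc : {linear ((A ⊗ B) ⊗ C)%type -> (A ⊗ (B ⊗ C))%type} :=
  tlift tassoc_fun.
Lemma tassocE a b c : tassoc (a *t b *t c) = a *t (b *t c).
Proof. by rewrite [LHS]tlift_pure [LHS]tlift_pure. Qed.
End Assoc.

(* the middle-four interchange *)
Section Interchange.
Variables (A B C D : lmodType k).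
Definition tswap_fun2 (a : A) (b : B) (c : C) (d : D) : (A ⊗ C) ⊗ (B ⊗ D)%type :=
  (a *t c) *t (b *t d).
Fact tswap_bilinear2 a b : bilinear_for *:%R *:%R (tswap_fun2 a b).
Proof.
by split=> [d e c c'|c e d d']; rewrite /tswap_fun2 linearPr ?linearPl ?linearPr.
Qed.
HB.instance Definition _ a b := bilinear_isBilinear.Build k C D
  ((A ⊗ C) ⊗ (B ⊗ D)%type)%type *:%R *:%R (tswap_fun2 a b) (tswap_bilinear2 a b).
Definition tswap_fun1 (u : C ⊗ D) (a : A) (b : B) : (A ⊗ C) ⊗ (B ⊗ D)%type :=
  tlift (tswap_fun2 a b) u.
Fact tswap_bilinear1 u : bilinear_for *:%R *:%R (tswap_fun1 u).
Proof.
split=> [b e a a'|a e b b']; rewrite /tswap_fun1 [u]tensor_sum_pure !linear_sum /=;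
  rewrite scaler_sumr -big_split /=; apply: eq_bigr => p _;
  by rewrite !tlift_pure /= /tswap_fun2 ?linearPl ?linearPr ?linearPl.
Qed.
HB.instance Definition _ u := bilinear_isBilinear.Build k A B
  ((A ⊗ C) ⊗ (B ⊗ D)%type)%type *:%R *:%R (tswap_fun1 u) (tswap_bilinear1 u).
Definition tswap_fun (t : A ⊗ B) (u : C ⊗ D) : (A ⊗ C) ⊗ (B ⊗ D)%type :=
  tlift (tswap_fun1 u) t.
Fact tswap_bilinear : bilinear_for *:%R *:%R tswap_fun.
Proof.
split=> [u e t t'|t e u u']; rewrite /tswap_fun; first by rewrite linearP.
rewrite [t]tensor_sum_pure !linear_sum /= scaler_sumr -big_split /=.
by apply: eq_bigr => p _; rewrite !tlift_pure /= /tswap_fun1 linearP.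
Qed.
HB.instance Definition _ := bilinear_isBilinear.Build k (A ⊗ B)%type (C ⊗ D)%type
  ((A ⊗ C) ⊗ (B ⊗ D)%type)%type *:%R *:%R tswap_fun tswap_bilinear.
Definition tswap :
    {linear ((A ⊗ B) ⊗ (C ⊗ D))%type -> ((A ⊗ C) ⊗ (B ⊗ D))%type} :=
  tlift tswap_fun.
Lemma tswapE a b c d : tswap ((a *t b) *t (c *t d)) = (a *t c) *t (b *t d).
Proof.
by rewrite [LHS]tlift_pure [LHS]tlift_pure [LHS]tlift_pure.
Qed.
End Interchange.

End TensorMaps.

Arguments tflip {k A B}.
Arguments tassoc {k A B C}.
Arguments tswap {k A B C D}.

(** * Almost Hopf algebras

    Algebras need not be unital, so the ring structures of the library do not
    apply: the product of [A] is a linear map [A ⊗ A -> A]. *)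

Section AlmostHopf.
Variable k : fieldType.

Definition alg_assoc (A : lmodType k) (mul : {linear (A ⊗ A)%type -> A}) : Prop :=
  forall x y z, mul (mul (x *t y) *t z) = mul (x *t mul (y *t z)).

Definition alg_comm (A : lmodType k) (mul : {linear (A ⊗ A)%type -> A}) : Prop :=
  forall x y, mul (x *t y) = mul (y *t x).

Definition alg_map (A B : lmodType k) (mulA : {linear (A ⊗ A)%type -> A})
    (mulB : {linear (B ⊗ B)%type -> B}) (f : {linear A -> B}) : Prop :=
  forall x y, f (mulA (x *t y)) = mulB (f x *t f y).

Definition tensor_mul (A B : lmodType k) (mulA : {linear (A ⊗ A)%type -> A})
    (mulB : {linear (B ⊗ B)%type -> B}) :
    {linear ((A ⊗ B) ⊗ (A ⊗ B))%type -> (A ⊗ B)%type} :=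
  tmap mulA mulB \o tswap.

Record almost_hopf_algebra (H HJ : lmodType k)
    (mul : {linear (H ⊗ H)%type -> H}) (mulJ : {linear (HJ ⊗ HJ)%type -> HJ})
    (eta : {linear HJ -> H}) (Delta : {linear H -> (H ⊗ H)%type})
    (eps : {linear H -> HJ}) (S : {linear H -> H}) : Prop := AlmostHopfAlgebra {
  ah_mul_assoc : alg_assoc mul;
  ah_mulJ_assoc : alg_assoc mulJ;
  ah_mulJ_comm : alg_comm mulJ;
  ah_coassoc : forall h : H,
    tassoc (tmap Delta idfun (Delta h)) = tmap idfun Delta (Delta h);
  ah_eps : forall h : H,
    tmap eps idfun (Delta h) = tflip (tmap idfun eps (Delta h));
  ah_eta : forall t : HJ ⊗ H,
    mul (tmap eta idfun t) = mul (tmap idfun eta (tflip t));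
  ah_antipode_l : forall h : H, mul (tmap S idfun (Delta h)) = eta (eps h);
  ah_antipode_r : forall h : H, mul (tmap idfun S (Delta h)) = eta (eps h);
  ah_Delta_map : alg_map mul (tensor_mul mul mul) Delta;
  ah_eps_map : alg_map mul mulJ eps;
  ah_eta_map : alg_map mulJ mul eta
}.

End AlmostHopf.

(** * Almost groups and matched pairs *)

Record almost_group (G : Type) := AlmostGroup {
  ag_mul : G -> G -> G;
  ag_inv : G -> G;
  ag_J : {pred G};
  ag_mulA : associative ag_mul;
  ag_inv_bij : bijective ag_inv;
  ag_J_mul : {in ag_J &, forall g h, ag_mul g h \in ag_J};
  ag_J_inv : {in ag_J, forall g, ag_inv g \in ag_J};
  ag_invM : forall g h, ag_inv (ag_mul g h) = ag_mul (ag_inv h) (ag_inv g);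
  ag_J_central : forall g, {in ag_J, forall j, ag_mul j g = ag_mul g j};
  ag_mulV : forall g, ag_mul g (ag_inv g) = ag_mul (ag_inv g) g;
  ag_mulV_J : forall g, ag_mul g (ag_inv g) \in ag_J;
  ag_invK : involutive ag_inv
}.

Record matched_pair (G M : Type) (AG : almost_group G) (AM : almost_group M) :=
    MatchedPair {
  mp_actr : M -> G -> G;  (* s ▷ u *)
  mp_actl : M -> G -> M;  (* s ◁ u *)
  mp_actl_mul : forall s u v,
    mp_actl s (ag_mul AG u v) = mp_actl (mp_actl s u) v;
  mp_mul_actl : forall s t u,
    mp_actl (ag_mul AM s t) u =
    ag_mul AM (mp_actl s (mp_actr t u)) (mp_actl t u);
  mp_mul_actr : forall s t u,
    mp_actr (ag_mul AM s t) u = mp_actr s (mp_actr t u);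
  mp_actr_mul : forall s u v,
    mp_actr s (ag_mul AG u v) =
    ag_mul AG (mp_actr s u) (mp_actr (mp_actl s u) v);
  mp_inv_actr : forall s u,
    mp_actr (ag_inv AM (mp_actl s u)) (ag_inv AG (mp_actr s u)) = ag_inv AG u;
  mp_inv_actl : forall s u,
    mp_actl (ag_inv AM (mp_actl s u)) (ag_inv AG (mp_actr s u)) = ag_inv AM s;
  mp_J_actr : {in ag_J AM, forall j u, mp_actr j u = u};
  mp_J_actl : {in ag_J AM, forall j u, mp_actl j u = j};
  mp_actr_J : forall s, {in ag_J AG, forall j, mp_actr s j = j};
  mp_actl_J : forall s, {in ag_J AG, forall j, mp_actl s j = s}
}.

Section SubJ.
Variables (G : Type) (A : almost_group G).

Definition sub_J := {j : G | j \in ag_J A}.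

Definition J_mul (i j : sub_J) : sub_J :=
  exist _ (ag_mul A (sval i) (sval j)) (ag_J_mul (svalP i) (svalP j)).

(* [g g^i], which always lies in [J] *)
Definition J_norm (g : G) : sub_J :=
  exist _ (ag_mul A g (ag_inv A g)) (ag_mulV_J A g).
End SubJ.

HB.instance Definition _ (G : finType) (A : almost_group G) :=
  Finite.copy (sub_J A) {j : G | j \in ag_J A}.

(** * Linear extension from a basis *)

Section FreeModule.
Variable k : fieldType.

(* the space with basis [I], with basis vectors [e_ i] *)
Definition free_on (I : finType) : lmodType k := {ffun I -> k^o}.
Definition basis_vec (I : finType) (i : I) : free_on I :=
  [ffun j => (j == i)%:R].

Section LinExt.
Variables (I : finType) (Z : lmodType k) (f : I -> Z).
Definition lin_ext (x : free_on I) : Z :=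
  \sum_i (x : {ffun I -> k^o}) i *: f i.
Fact lin_ext_linear : linear lin_ext.
Proof.
move=> a x y; rewrite /lin_ext scaler_sumr -big_split /=.
by apply: eq_bigr => i _; rewrite !ffunE scalerDl scalerA.
Qed.
HB.instance Definition _ := GRing.isLinear.Build k (free_on I) Z _ lin_ext
  lin_ext_linear.
Lemma lin_ext_basis i : lin_ext (basis_vec i) = f i.
Proof.
rewrite /lin_ext (bigD1 i) //= ffunE eqxx scale1r big1 ?addr0 // => j /negPf ji.
by rewrite ffunE ji scale0r.
Qed.
End LinExt.

Lemma basis_decomp (I : finType) (x : free_on I) : x = lin_ext (@basis_vec I) x.
Proof.
apply/ffunP => j; rewrite /lin_ext sum_ffunE (bigD1 j) //= !ffunE eqxx.
rewrite big1 ?addr0 => [|i /negPf ij]; first by rewrite /GRing.scale /= mulr1.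
by rewrite !ffunE eq_sym ij scaler0.
Qed.

(* the linear map on [free_on I ⊗ free_on J] with prescribed values
   [f i j] at [e_ i ⊗ e_ j] *)
Section BilinExt.
Variables (I J : finType) (Z : lmodType k) (f : I -> J -> Z).
Definition bilin_ext_fun (x : free_on I) (y : free_on J) : Z :=
  lin_ext (fun i => lin_ext (f i) y) x.
Fact bilin_ext_bilinear : bilinear_for *:%R *:%R bilin_ext_fun.
Proof.
split=> [y a x x'|x a y y']; rewrite /bilin_ext_fun; first by rewrite linearP.
have E (g : I -> Z) : lin_ext g x = \sum_i (x : {ffun I -> k^o}) i *: g i by [].
rewrite !E /= scaler_sumr -big_split /=; apply: eq_bigr => i _.
by rewrite linearP scalerDr !scalerA mulrC.
Qed.
HB.instance Definition _ := bilinear_isBilinear.Build k (free_on I) (free_on J)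
  Z *:%R *:%R bilin_ext_fun bilin_ext_bilinear.
Definition bilin_ext : {linear (free_on I ⊗ free_on J)%type -> Z} :=
  tlift bilin_ext_fun.
Lemma bilin_ext_basis i j : bilin_ext (basis_vec i *t basis_vec j) = f i j.
Proof. by rewrite [LHS]tlift_pure /= /bilin_ext_fun !lin_ext_basis. Qed.
End BilinExt.

End FreeModule.

(** * The almost Hopf algebra of a matched pair *)

Section Bicross.
Variables (k : fieldType) (G M : finType).
Variables (AG : almost_group G) (AM : almost_group M) (P : matched_pair AG AM).

Local Notation mulG := (ag_mul AG).
Local Notation mulM := (ag_mul AM).
Local Notation invG := (ag_inv AG).
Local Notation invM := (ag_inv AM).
Local Notation "s ▷ u" := (mp_actr P s u) (at level 38).
Local Notation "s ◁ u" := (mp_actl P s u) (at level 38).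

(* the pair [(s, u)] indexes the basis vector [s ⊗ δ_u] *)
Definition bic_H : lmodType k := free_on k (M * G)%type.
Definition bic_HJ : lmodType k := free_on k (sub_J AM * sub_J AG)%type.

Definition bas (s : M) (u : G) : bic_H := basis_vec k (s, u).
Definition basJ (j : sub_J AM) (n : sub_J AG) : bic_HJ := basis_vec k (j, n).

Definition bic_mul : {linear (bic_H ⊗ bic_H)%type -> bic_H} :=
  bilin_ext (fun '(s, u) '(t, v) => if u == t ▷ v then bas (mulM s t) v else 0).

Definition bic_mulJ : {linear (bic_HJ ⊗ bic_HJ)%type -> bic_HJ} :=
  bilin_ext (fun '(j, n) '(j', n') =>
    if n == n' then basJ (J_mul j j') n' else 0).

Definition bic_Delta : {linear bic_H -> (bic_H ⊗ bic_H)%type} :=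
  lin_ext (fun '(s, u) =>
    \sum_x \sum_(y | mulG x y == u) bas s x *t bas (s ◁ x) y).

Definition bic_S : {linear bic_H -> bic_H} :=
  lin_ext (fun '(s, u) => bas (invM (s ◁ u)) (invG (s ▷ u))).

(* [insub u] is [Some n] with [sval n = u] if [u] lies in [J_G], else [None] *)
Definition bic_eps : {linear bic_H -> bic_HJ} :=
  lin_ext (fun '(s, u) =>
    if insub u is Some n then basJ (J_norm AM s) n else 0).

Definition bic_eta : {linear bic_HJ -> bic_H} :=
  lin_ext (fun '(j, n) => \sum_(z | mulG z (invG z) == sval n) bas (sval j) z).

End Bicross.

(* Main.v *)
(** All maps are determined by basis vectors, where the axioms not read off
    from the matched pair relations reduce to three identities:
    (s ◁ u) ▷ u^i = (s ▷ u)^i,  (s ▷ u)(s ▷ u)^i = u u^i  and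
    (s ◁ u)(s ◁ u)^i = s s^i.  Almost groups have no cancellation, but s ▷ is
    invertible with inverse s^i ▷, because s s^i lies in J and acts trivially;
    this lets the sums in the antipode axioms collapse. *)

Require Import Defs.
From mathcomp Require Import all_boot all_order all_algebra.

Set Implicit Arguments.
Unset Strict Implicit.
Unset Printing Implicit Defensive.

Import GRing.Theory.
Local Open Scope ring_scope.

(** The closure hypothesis has the shape of [linearP], so each identity between linear maps passes
    its inductive case by one rewrite and only basis vectors remain. *)
Lemma free_on_ind (k : fieldType) (I : finType) (Q : free_on k I -> Prop) :
    Q 0 -> (forall a x y, Q x -> Q y -> Q (a *: x + y)) ->
    (forall i, Q (basis_vec k i)) -> forall x, Q x.
Proof.
move=> Q0 QP Qb x; rewrite (basis_decomp x) /lin_ext.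
by elim/big_rec: _ => // i y _ Qy; exact: QP.
Qed.

Lemma tensor_ind (k : fieldType) (V W : lmodType k) (Q : tensor V W -> Prop) :
    Q 0 -> (forall x y, Q x -> Q y -> Q (x + y)) ->
    (forall v w, Q (v *t w)) -> forall t, Q t.
Proof.
by move=> Q0 QD Qp t; rewrite (tensor_sum_pure t); elim/big_ind: _.
Qed.

Lemma tensor_mulE (k : fieldType) (A B : lmodType k)
    (mulA : {linear tensor A A -> A}) (mulB : {linear tensor B B -> B}) a b a' b' :
  tensor_mul mulA mulB ((a *t b) *t (a' *t b')) =
  mulA (a *t a') *t mulB (b *t b').
Proof. by rewrite /tensor_mul /= tswapE tmapE. Qed.

(** Collapses a sum whose index is fixed by a Kronecker delta; the other condition survives as a
    test at that index. *)
Lemma big_and_pred1 (I : finType) (V : nmodType) (Q : pred I) a (F : I -> V) :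
  \sum_(i | Q i && (i == a)) F i = if Q a then F a else 0.
Proof.
case: ifPn => [Qa|/negPf nQa].
  by rewrite (big_pred1 a) // => i; rewrite /= andbC; case: eqP => [->|].
by rewrite big_pred0 // => i; rewrite andbC; case: eqP => [->|].
Qed.

(** * Consequences of the matched pair relations *)

Section Antipode.
Variables (G M : Type) (AG : almost_group G) (AM : almost_group M).
Variable P : matched_pair AG AM.

Local Notation mulG := (ag_mul AG).
Local Notation mulM := (ag_mul AM).
Local Notation invG := (ag_inv AG).
Local Notation invM := (ag_inv AM).
Local Notation "s ▷ u" := (mp_actr P s u) (at level 38).
Local Notation "s ◁ u" := (mp_actl P s u) (at level 38).

Lemma actr_invK s : cancel (mp_actr P s) (mp_actr P (invM s)).
Proof.
by move=> u; rewrite -mp_mul_actr -ag_mulV (mp_J_actr P (ag_mulV_J AM s)).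
Qed.

Lemma actr_invKV s : cancel (mp_actr P (invM s)) (mp_actr P s).
Proof. by move=> u; rewrite -mp_mul_actr (mp_J_actr P (ag_mulV_J AM s)). Qed.

Lemma actr_actl_inv s u : (s ◁ u) ▷ invG u = invG (s ▷ u).
Proof. by rewrite -(mp_inv_actr P s u) actr_invKV. Qed.

(** The element u u^i of [ag_J AG] is fixed by s ▷; expand s ▷ (u u^i) by the product rule. *)
Lemma actr_norm s u :
  mulG (s ▷ u) (invG (s ▷ u)) = mulG u (invG u).
Proof.
by rewrite -actr_actl_inv -mp_actr_mul (mp_actr_J P s (ag_mulV_J AG u)).
Qed.

(** The left side lies in [ag_J AM], so acting on it by (s ▷ u)^i changes nothing. This acting
    element makes both inverse relations apply: the product rule gives ((s ◁ u) ◁ u^i) s^i, and u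
    u^i acts trivially on s. *)
Lemma actl_norm s u :
  mulM (s ◁ u) (invM (s ◁ u)) = mulM s (invM s).
Proof.
rewrite -{1}(mp_J_actl P (ag_mulV_J AM (s ◁ u)) (invG (s ▷ u))).
rewrite mp_mul_actl mp_inv_actr mp_inv_actl -mp_actl_mul.
by rewrite (mp_actl_J P s (ag_mulV_J AG u)).
Qed.

Lemma ag_norm_inv g : mulG (invG g) (invG (invG g)) = mulG g (invG g).
Proof. by rewrite ag_invK ag_mulV. Qed.

Lemma ag_normM s t : mulM (mulM s t) (invM (mulM s t)) =
  mulM (mulM s (invM s)) (mulM t (invM t)).
Proof.
rewrite ag_invM -!ag_mulA; congr ag_mul.
by rewrite [LHS]ag_mulA (ag_J_central _ (ag_mulV_J AM t)).
Qed.

End Antipode.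

(** * The structure maps on basis vectors *)

Section BasisFormulas.
Variables (k : fieldType) (G M : finType).
Variables (AG : almost_group G) (AM : almost_group M) (P : matched_pair AG AM).

Local Notation mulG := (ag_mul AG).
Local Notation mulM := (ag_mul AM).
Local Notation invG := (ag_inv AG).
Local Notation invM := (ag_inv AM).
Local Notation "s ▷ u" := (mp_actr P s u) (at level 38).
Local Notation "s ◁ u" := (mp_actl P s u) (at level 38).
Local Notation bas := (@bas k G M).
Local Notation basJ := (@basJ k G M AG AM).
Local Notation mul := (bic_mul k P).
Local Notation mulJ := (bic_mulJ k AG AM).
Local Notation eta := (bic_eta k AG AM).
Local Notation Delta := (bic_Delta k P).
Local Notation eps := (bic_eps k AG AM).
Local Notation S := (bic_S k P).

Lemma linear_if (V W : lmodType k) (f : {linear V -> W}) b x :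
  f (if b then x else 0) = if b then f x else 0.
Proof. by case: b; rewrite ?linear0. Qed.

Lemma bic_mulE s u t v :
  mul (bas s u *t bas t v) = if u == t ▷ v then bas (mulM s t) v else 0.
Proof. exact: bilin_ext_basis. Qed.

Lemma bic_mulJE j n j' n' :
  mulJ (basJ j n *t basJ j' n') = if n == n' then basJ (J_mul j j') n' else 0.
Proof. exact: bilin_ext_basis. Qed.

Lemma bic_DeltaE s u : Delta (bas s u) =
  \sum_x \sum_(y | mulG x y == u) bas s x *t bas (s ◁ x) y.
Proof. exact: lin_ext_basis. Qed.

Lemma bic_SE s u : S (bas s u) = bas (invM (s ◁ u)) (invG (s ▷ u)).
Proof. exact: lin_ext_basis. Qed.

Lemma bic_epsE s u : eps (bas s u) =
  if insub u is Some n then basJ (J_norm AM s) n else 0.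
Proof. exact: lin_ext_basis. Qed.

Lemma bic_etaE j n : eta (basJ j n) =
  \sum_(z | mulG z (invG z) == sval n) bas (sval j) z.
Proof. exact: lin_ext_basis. Qed.

Lemma linear_Delta (Z : lmodType k)
    (f : {linear tensor (bic_H k G M) (bic_H k G M) -> Z}) s u :
  f (Delta (bas s u)) =
  \sum_x \sum_(y | mulG x y == u) f (bas s x *t bas (s ◁ x) y).
Proof.
by rewrite bic_DeltaE linear_sum; under eq_bigr do rewrite linear_sum.
Qed.

(** * Algebra axioms *)

Lemma bic_mul_assoc : alg_assoc mul.
Proof.
move=> x y z.
elim/free_on_ind: x => [|a x x' IHx IHx'|[s u]].
- by rewrite !(linear0l, linear0).
- by rewrite !(linearPl, linearP) /= IHx IHx'.
elim/free_on_ind: y => [|a x x' IHx IHx'|[t v]].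
- by rewrite !(linear0l, linear0r, linear0).
- by rewrite !(linearPl, linearPr, linearP) /= IHx IHx'.
elim/free_on_ind: z => [|a x x' IHx IHx'|[r w]].
- by rewrite !(linear0l, linear0r, linear0).
- by rewrite !(linearPl, linearPr, linearP) /= IHx IHx'.
rewrite -!/(bas _ _) !bic_mulE.
(* Both sides require v = r ▷ w; the remaining conditions u = t ▷ v and u = tr ▷ w then coincide. *)
case: (eqVneq v (r ▷ w)) => [->|nv].
  rewrite bic_mulE mp_mul_actr; case: eqP => _; last by rewrite linear0l linear0.
  by rewrite bic_mulE eqxx ag_mulA.
rewrite linear0r linear0; case: eqP => _; last by rewrite linear0l linear0.
by rewrite bic_mulE (negPf nv).
Qed.

Lemma bic_mulJ_assoc : alg_assoc mulJ.
Proof.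
move=> x y z.
elim/free_on_ind: x => [|a x x' IHx IHx'|[s u]].
- by rewrite !(linear0l, linear0).
- by rewrite !(linearPl, linearP) /= IHx IHx'.
elim/free_on_ind: y => [|a x x' IHx IHx'|[t v]].
- by rewrite !(linear0l, linear0r, linear0).
- by rewrite !(linearPl, linearPr, linearP) /= IHx IHx'.
elim/free_on_ind: z => [|a x x' IHx IHx'|[r w]].
- by rewrite !(linear0l, linear0r, linear0).
- by rewrite !(linearPl, linearPr, linearP) /= IHx IHx'.
rewrite -!/(basJ _ _) !bic_mulJE.
case: (eqVneq v w) => [->|nv].
  rewrite bic_mulJE; case: eqP => _; last by rewrite linear0l linear0.
  rewrite bic_mulJE eqxx; congr (basJ _ _).
  by apply: val_inj; rewrite /= ag_mulA.
rewrite linear0r linear0; case: eqP => _; last by rewrite linear0l linear0.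
by rewrite bic_mulJE (negPf nv).
Qed.

Lemma bic_mulJ_comm : alg_comm mulJ.
Proof.
move=> x y.
elim/free_on_ind: x => [|a x x' IHx IHx'|[i u]].
- by rewrite !(linear0l, linear0r, linear0).
- by rewrite !(linearPl, linearPr, linearP) /= IHx IHx'.
elim/free_on_ind: y => [|a x x' IHx IHx'|[j v]].
- by rewrite !(linear0l, linear0r, linear0).
- by rewrite !(linearPl, linearPr, linearP) /= IHx IHx'.
rewrite -!/(basJ _ _) !bic_mulJE eq_sym; case: eqP => // ->.
by congr (basJ _ _); apply: val_inj; exact: ag_J_central (svalP i).
Qed.

(** * Coassociativity and the axioms for [eps] and [eta] *)

Lemma bic_coassoc h :
  tassoc (tmap Delta idfun (Delta h)) = tmap idfun Delta (Delta h).
Proof.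
elim/free_on_ind: h => [|a x y IHx IHy|[s u]].
- by rewrite !linear0.
- by rewrite !linearP /= IHx IHy.
rewrite -!/(bas _ _) [LHS](linear_Delta (tassoc \o tmap Delta idfun)) linear_Delta.
transitivity (\sum_w \sum_(z | mulG w z == u) \sum_x \sum_(y | mulG x y == w)
    bas s x *t (bas (s ◁ x) y *t bas (s ◁ w) z)).
  apply: eq_bigr => w _; apply: eq_bigr => z _.
  rewrite /= tmapE bic_DeltaE linear_sumlz linear_sum; apply: eq_bigr => x _.
  rewrite linear_sumlz linear_sum; apply: eq_bigr => y _.
  by rewrite tassocE.
(* The index w is determined by w = xy, leaving a sum over factorisations of u into three. *)
transitivity (\sum_x \sum_y \sum_(z | mulG (mulG x y) z == u)
    bas s x *t (bas (s ◁ x) y *t bas (s ◁ mulG x y) z)).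
  under eq_bigr do rewrite exchange_big; rewrite exchange_big.
  apply: eq_bigr => x _; under eq_bigr do rewrite exchange_big.
  rewrite (exchange_big_dep xpredT) //=; apply: eq_bigr => y _.
  by rewrite (big_pred1 (mulG x y)) // => w; rewrite eq_sym.
apply: eq_bigr => x _.
under [RHS]eq_bigr do rewrite /= tmapE bic_DeltaE linear_sumr.
rewrite [RHS]exchange_big; apply: eq_bigr => y _.
under [RHS]eq_bigr do rewrite linear_sumr.
(* On the right, the intermediate index is eliminated as yz. *)
rewrite [RHS](exchange_big_dep xpredT) //= big_mkcond; apply: eq_bigr => z _.
under [RHS]eq_bigl do rewrite [mulG y z == _]eq_sym.
by rewrite big_and_pred1 ag_mulA mp_actl_mul.
Qed.

Lemma bic_eps_counit h :
  tmap eps idfun (Delta h) = tflip (tmap idfun eps (Delta h)).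
Proof.
elim/free_on_ind: h => [|a x y IHx IHy|[s u]].
- by rewrite !linear0.
- by rewrite !linearP /= IHx IHy.
rewrite -!/(bas _ _) linear_Delta [RHS](linear_Delta (tflip \o tmap idfun eps)).
(* The outer index becomes the one fed to [eps] on both sides. Only its values in [ag_J AG]
   contribute; these are central, so xy = u and yx = u agree. *)
rewrite [RHS](exchange_big_dep xpredT) //=.
apply: eq_bigr => x _.
under eq_bigr do rewrite tmapE bic_epsE.
under [RHS]eq_bigr do rewrite tmapE tflipE bic_epsE.
case: insubP => [n _ nx|_]; last by rewrite !big1 // => y _; rewrite linear0l.
have Jx : x \in ag_J AG by rewrite -nx; exact: svalP n.
apply: eq_big => [y|y _]; first by rewrite (ag_J_central _ Jx).
rewrite (mp_actl_J P s Jx); congr (basJ _ _ *t _).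
by apply: val_inj; rewrite /= actl_norm.
Qed.

Lemma bic_eta_central t : mul (tmap eta idfun t) = mul (tmap idfun eta (tflip t)).
Proof.
elim/tensor_ind: t => [|t t' IHt IHt'|x y].
- by rewrite !linear0.
- by rewrite !linearD /= IHt IHt'.
rewrite tflipE !tmapE /=.
elim/free_on_ind: x => [|a x x' IHx IHx'|[j n]].
- by rewrite !(linear0, linear0l, linear0r).
- by rewrite !linearP linearPl linearPr !linearP /= IHx IHx'.
elim/free_on_ind: y => [|a x x' IHx IHx'|[s u]].
- by rewrite !(linear0, linear0l, linear0r).
- by rewrite linearPl linearPr !linearP /= IHx IHx'.
rewrite -/(basJ _ _) -/(bas _ _) bic_etaE linear_sumlz linear_sumr !linear_sum /=.
under eq_bigr do rewrite bic_mulE.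
under [RHS]eq_bigr do rewrite bic_mulE (mp_J_actr P (svalP j)).
rewrite -!big_mkcondr /= -(ag_J_central _ (svalP j)).
(* The deltas force z = s ▷ u on the left and z = u on the right; since s ▷ preserves z z^i, both
   tests against n become u u^i = n. *)
rewrite (eq_bigl
    (fun z => (mulG u (invG u) == sval n) && (z == s ▷ u))); last first.
  by move=> z; rewrite andbC [RHS]andbC; case: eqP => //= ->; rewrite actr_norm.
rewrite [RHS](eq_bigl
    (fun z => (mulG u (invG u) == sval n) && (z == u))); last first.
  by move=> z; rewrite andbC [RHS]andbC eq_sym; case: eqP => //= ->.
by rewrite !big_and_pred1.
Qed.

(** * Antipode axioms *)

Lemma bic_eta_eps s u : eta (eps (bas s u)) =
  \sum_(z | mulG z (invG z) == u) bas (mulM s (invM s)) z.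
Proof.
rewrite bic_epsE; case: insubP => [n _ <-|nJu]; first by rewrite bic_etaE.
(* For u outside [ag_J AG] the sum is empty, because every z z^i lies in [ag_J AG]. *)
rewrite linear0 big_pred0 // => z; apply: contraNF nJu => /eqP <-.
exact: ag_mulV_J.
Qed.

Lemma bic_antipode_l h : mul (tmap S idfun (Delta h)) = eta (eps h).
Proof.
elim/free_on_ind: h => [|a x y IHx IHy|[s u]].
- by rewrite !linear0.
- by rewrite !linearP /= IHx IHy.
rewrite -!/(bas _ _) bic_eta_eps [LHS](linear_Delta (mul \o tmap S idfun)).
(* The delta (s ▷ x)^i = (s ◁ x) ▷ y forces y = x^i, and the product is supported at y: hence z =
   x^i. *)
rewrite [RHS](reindex_inj (inv_inj (ag_invK AG))) [RHS]big_mkcond /=.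
apply: eq_bigr => x _; rewrite ag_norm_inv.
under eq_bigr do rewrite tmapE bic_SE bic_mulE -ag_mulV actl_norm -actr_actl_inv
  (can_eq (actr_invK P (s ◁ x))) eq_sym.
by rewrite -big_mkcondr big_and_pred1.
Qed.

Lemma bic_antipode_r h : mul (tmap idfun S (Delta h)) = eta (eps h).
Proof.
elim/free_on_ind: h => [|a x y IHx IHy|[s u]].
- by rewrite !linear0.
- by rewrite !linearP /= IHx IHy.
rewrite -!/(bas _ _) bic_eta_eps [LHS](linear_Delta (mul \o tmap idfun S)).
(* Here too y = x^i, but the product is supported at ((s ◁ x) ▷ x^i)^i = s ▷ x: hence z = s ▷ x. *)
rewrite [RHS](reindex_inj (can_inj (actr_invK P s))) [RHS]big_mkcond /=.
apply: eq_bigr => x _; rewrite actr_norm.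
under eq_bigr do rewrite tmapE bic_SE bic_mulE mp_inv_actr eq_sym
  (inv_eq (ag_invK AG)).
rewrite -big_mkcondr big_and_pred1 -mp_actl_mul (mp_actl_J P s (ag_mulV_J AG x)).
by rewrite actr_actl_inv ag_invK.
Qed.

(** * Multiplicativity of [Delta], [eps] and [eta] *)

Lemma bic_Delta_map : alg_map mul (tensor_mul mul mul) Delta.
Proof.
move=> x y.
elim/free_on_ind: x => [|a x x' IHx IHx'|[s u]].
- by rewrite !(linear0, linear0l).
- by rewrite !(linearP, linearPl) /= IHx IHx'.
elim/free_on_ind: y => [|a x x' IHx IHx'|[t v]].
- by rewrite !(linear0, linear0r).
- by rewrite !(linearP, linearPr) /= IHx IHx'.
rewrite -!/(bas _ _) bic_mulE linear_if (bic_DeltaE t) linear_sumr linear_sum.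
rewrite [LHS](_ : _ = \sum_x \sum_(y | mulG x y == v) if u == t ▷ v then
    bas (mulM s t) x *t bas (mulM s t ◁ x) y else 0); last first.
  rewrite bic_DeltaE; case: eqP => // _.
  by rewrite big1 // => x _; rewrite big1.
apply: eq_bigr => x _; rewrite linear_sumr linear_sum.
apply: eq_bigr => y /eqP <-.
rewrite bic_DeltaE linear_sumlz [RHS]linear_sum.
(* The two products force a = t ▷ x and b = (t ◁ x) ▷ y, so ab = t ▷ xy and the condition ab = u is
   the delta of the left side. *)
transitivity (\sum_(a | a == t ▷ x)
    \sum_(b | (mulG a b == u) && (b == (t ◁ x) ▷ y))
    bas (mulM s t) x *t bas (mulM (s ◁ a) (t ◁ x)) y).
  rewrite (big_pred1 (t ▷ x)) // big_and_pred1 mp_actr_mul mp_mul_actl.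
  by rewrite eq_sym.
rewrite big_mkcond; apply: eq_bigr => a _.
rewrite linear_sumlz [RHS]linear_sum big_mkcondr.
case: eqP => [->|/eqP/negPf na].
  apply: eq_bigr => b _; rewrite tensor_mulE !bic_mulE eqxx.
  by case: eqP => // _; rewrite linear0r.
by rewrite big1 // => b _; rewrite tensor_mulE !bic_mulE na linear0l.
Qed.

Lemma bic_eps_map : alg_map mul mulJ eps.
Proof.
move=> x y.
elim/free_on_ind: x => [|a x x' IHx IHx'|[s u]].
- by rewrite !(linear0, linear0l).
- by rewrite !(linearP, linearPl) /= IHx IHx'.
elim/free_on_ind: y => [|a x x' IHx IHx'|[t v]].
- by rewrite !(linear0, linear0r).
- by rewrite !(linearP, linearPr) /= IHx IHx'.
rewrite -!/(bas _ _) bic_mulE linear_if !bic_epsE.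
(* For v in [ag_J AG], t ▷ v = v, so the delta of [mul] becomes u = v, as in [mulJ]. *)
case: (insubP _ v) => [n Jv <-|nJv]; last by rewrite if_same linear0r linear0.
rewrite (mp_actr_J P t (svalP n)).
case: insubP => [m Ju <-|nJu]; last first.
  rewrite linear0l linear0; case: eqP => // eun; case/negP: nJu.
  by rewrite eun; exact: svalP n.
rewrite bic_mulJE -val_eqE; case: eqP => // _.
by congr (basJ _ _); apply: val_inj; exact: ag_normM.
Qed.

Lemma bic_eta_map : alg_map mulJ mul eta.
Proof.
move=> x y.
elim/free_on_ind: x => [|a x x' IHx IHx'|[j n]].
- by rewrite !(linear0, linear0l).
- by rewrite !(linearP, linearPl) /= IHx IHx'.
elim/free_on_ind: y => [|a x x' IHx IHx'|[j' n']].
- by rewrite !(linear0, linear0r).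
- by rewrite !(linearP, linearPr) /= IHx IHx'.
rewrite -!/(basJ _ _) bic_mulJE linear_if !bic_etaE.
rewrite linear_sumr linear_sum /=.
rewrite [LHS](_ : _ = \sum_(z | mulG z (invG z) == sval n')
    if n == n' then bas (mulM (sval j) (sval j')) z else 0); last first.
  by case: eqP => // _; rewrite big1.
(* As j' acts trivially, the inner index must equal z, so its constraint reads n = z z^i = n'. *)
apply: eq_bigr => z /eqP nz; rewrite linear_sumlz linear_sum.
under [RHS]eq_bigr do rewrite bic_mulE (mp_J_actr P (svalP j')).
by rewrite -big_mkcondr big_and_pred1 nz eq_sym.
Qed.

End BasisFormulas.

Theorem mainTheorem1 (k : fieldType) (G M : finType)
    (AG : almost_group G) (AM : almost_group M) (P : matched_pair AG AM) :
  almost_hopf_algebra (bic_mul k P) (bic_mulJ k AG AM) (bic_eta k AG AM)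
    (bic_Delta k P) (bic_eps k AG AM) (bic_S k P).
Proof.
split.
- exact: bic_mul_assoc.
- exact: bic_mulJ_assoc.
- exact: bic_mulJ_comm.
- exact: bic_coassoc.
- exact: bic_eps_counit.
- exact: bic_eta_central.
- exact: bic_antipode_l.
- exact: bic_antipode_r.
- exact: bic_Delta_map.
- exact: bic_eps_map.
- exact: bic_eta_map.
Qed.
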